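(* Let $\{F^k\}_{k\in\mathbb{N}_0}$ be the pullback attractor of a non-autonomous iterated function system of similarities on $\mathbb{R}^d$ satisfying the (generalised) Moran open-set condition. Suppose that for each $k\in\mathbb{N}$ there is a number $c_k$ with $\sigma_i=c_k$ for all $i\in\mathcal{I}_k$, and that there exists $N>0$ such that $\mathrm{card}(\mathcal{I}_k)\le N$ for all $k\in\mathbb{N}$. Then each set $F^k$ is equi-homogeneous.
   Context: $\mathbb{N}=\{1,2,\dots\}$, $\mathbb{N}_0=\mathbb{N}\cup\{0\}$. A non-autonomous iterated function system on $\mathbb{R}^d$ consists of contractions $f_i:\mathbb{R}^d\to\mathbb{R}^d$ ($i\in\mathbb{N}$) with $|f_i(x)-f_i(y)|\le\sigma_i|x-y|$ for all $x,y$, where $\sigma_i\in(0,1)$, and finite index sets $\mathcal{I}_k\subset\mathbb{N}$ ($k\in\mathbb{N}$). It is a system of similarities if this inequality is an equality for every $i$. For $B\subseteq\mathbb{R}^d$ put $\mathcal{S}^k(B)=\bigcup_{i\in\mathcal{I}_{k+1}}f_i(B)$, $\mathcal{S}^{k,l}(B)=\mathcal{S}^k\circ\cdots\circ\mathcal{S}^{l-1}(B)$ for $k<l$, and $\mathcal{S}^{k,k}(B)=B$. Hausdorff semi-distance: $\rho_H(X,Y)=\sup_{x\in X}\inf_{y\in Y}|x-y|$. A pullback attractor is a collection of sets $\{F^k\}_{k\in\mathbb{N}_0}$ in $\mathbb{R}^d$ such that (1) each $F^k$ is compact and the $F^k$ are uniformly bounded; (2) $F^k=\mathcal{S}^k(F^{k+1})$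 for all $k$; (3) $\rho_H(\mathcal{S}^{k,l}(B),F^k)\to0$ as $l\to\infty$ for every $k$ and every bounded $B\subset\mathbb{R}^d$. Generalised Moran open-set condition: there is a uniformly bounded sequence of non-empty open sets $U^k\subset\mathbb{R}^d$ ($k\in\mathbb{N}_0$) such that (i) $\mathcal{S}^k(U^{k+1})\subseteq U^k$; (ii) $f_i(U^k)\cap f_j(U^k)=\emptyset$ for $i,j\in\mathcal{I}_k$, $i\ne j$; (iii) there is $\epsilon_0>0$ with $\lambda(U^k)\ge\epsilon_0$ for all $k\in\mathbb{N}_0$, where $\lambda$ is $d$-dimensional Lebesgue measure. $B_\delta(x)$ is the closed ball of radius $\delta$ and centre $x$, and $\mathcal{N}(A,\delta)$ is the minimum number of closed balls of radius $\delta$ with centres in $A$ whose union contains $A$. A set $F$ is equi-homogeneous if for all $\delta_0>0$ there exist $M\ge 1$ and $c_1,c_2>0$ such that $\sup_{x\in F}\mathcal{N}(B_\delta(x)\cap F,\rho)\le M\inf_{x\in F}\mathcal{N}(B_{c_1\delta}(x)\cap F,c_2\rho)$ for all $\delta,\rho$ with $0<\rho<\delta\le\delta_0$. *)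

(* Defs.v *)
From HB Require Import structures.
From mathcomp Require Import all_boot all_order all_algebra finmap.
From mathcomp Require Import all_classical all_reals all_analysis.

Set Implicit Arguments.
Unset Strict Implicit.
Unset Printing Implicit Defensive.

Import Order.TTheory GRing.Theory Num.Theory.
Import numFieldNormedType.Exports.

Local Open Scope classical_set_scope.
Local Open Scope ring_scope.

(* The library norm on 'rV[R]_d is the sup norm, so the Euclidean norm is
   introduced here. The two are equivalent: the library notions open, compact
   and bounded_set are the Euclidean ones. *)
Definition enorm (R : realType) (d : nat) (x : 'rV[R]_d) : R :=
  Num.sqrt (\sum_(i < d) x 0 i ^+ 2).

Definition eball (R : realType) (d : nat) (x : 'rV[R]_d) (delta : R) :
    set 'rV[R]_d :=
  closed_ball_ (@enorm R d) x delta.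

Definition box (R : realType) (d : nat) (a b : 'rV[R]_d) : set 'rV[R]_d :=
  [set x | forall i : 'I_d, a 0 i <= x 0 i <= b 0 i].

(* d-dimensional Lebesgue outer measure, for 0 < d; on measurable (in
   particular open) sets it is Lebesgue measure. *)
Definition lebesgue_d (R : realType) (d : nat) (A : set 'rV[R]_d) : \bar R :=
  ereal_inf
    [set (\sum_(0 <= k <oo)
            (\prod_(i < d) ((ab k).2 0 i - (ab k).1 0 i))%:E)%E
    | ab in [set ab : nat -> 'rV[R]_d * 'rV[R]_d |
        (forall k (i : 'I_d), (ab k).1 0 i <= (ab k).2 0 i) /\
        A `<=` \bigcup_k box (ab k).1 (ab k).2]].

(* The set of positive natural numbers indexes the maps f i, the ratios sigma i
   and the finite index sets I k; the values f 0, sigma 0 and I 0 are junk. *)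
Record nonautonomous_ifs (R : realType) (d : nat)
    (f : nat -> 'rV[R]_d -> 'rV[R]_d) (sigma : nat -> R)
    (I : nat -> {fset nat}) : Prop := NonautonomousIfs {
  nifs_ratio : forall i, (0 < i)%N -> 0 < sigma i < 1;
  nifs_contraction : forall i, (0 < i)%N ->
    forall x y, enorm (f i x - f i y) <= sigma i * enorm (x - y);
  nifs_index : forall k i, (0 < k)%N -> i \in I k -> (0 < i)%N }.

Definition ifs_similarities (R : realType) (d : nat)
    (f : nat -> 'rV[R]_d -> 'rV[R]_d) (sigma : nat -> R) : Prop :=
  forall i, (0 < i)%N ->
    forall x y, enorm (f i x - f i y) = sigma i * enorm (x - y).

Definition ifs_map (R : realType) (d : nat)
    (f : nat -> 'rV[R]_d -> 'rV[R]_d) (I : nat -> {fset nat})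
    (k : nat) (B : set 'rV[R]_d) : set 'rV[R]_d :=
  \bigcup_(i in [set` I k.+1]) (f i @` B).

Definition ifs_iter (R : realType) (d : nat)
    (f : nat -> 'rV[R]_d -> 'rV[R]_d) (I : nat -> {fset nat})
    (k l : nat) (B : set 'rV[R]_d) : set 'rV[R]_d :=
  foldr (ifs_map f I) B (index_iota k l).

(* Suprema of distances are taken in [0, +oo], so that the supremum over the
   empty set is 0 and not -oo. *)
Definition hausdorff_semidist (R : realType) (d : nat)
    (X Y : set 'rV[R]_d) : \bar R :=
  maxe 0%E
    (ereal_sup [set ereal_inf [set (enorm (x - y))%:E | y in Y] | x in X]).

Record pullback_attractor (R : realType) (d : nat)
    (f : nat -> 'rV[R]_d -> 'rV[R]_d) (I : nat -> {fset nat})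
    (F : nat -> set 'rV[R]_d) : Prop := PullbackAttractor {
  pa_compact : forall k, compact (F k);
  pa_bounded : bounded_set (\bigcup_k F k);
  pa_invariant : forall k, F k = ifs_map f I k (F k.+1);
  pa_attracting : forall k (B : set 'rV[R]_d), bounded_set B ->
    hausdorff_semidist (ifs_iter f I k l B) (F k) @[l --> \oo] --> 0%E }.

Definition moran_open_set_condition (R : realType) (d : nat)
    (f : nat -> 'rV[R]_d -> 'rV[R]_d) (I : nat -> {fset nat}) : Prop :=
  exists U : nat -> set 'rV[R]_d,
    [/\ forall k, open (U k) /\ U k !=set0,
        bounded_set (\bigcup_k U k),
        forall k, ifs_map f I k (U k.+1) `<=` U k,
        forall k i j, (0 < k)%N -> i \in I k -> j \in I k -> i != j ->
          f i @` U k `&` f j @` U k = set0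
      & exists2 eps0 : R, 0 < eps0 & forall k, (eps0%:E <= lebesgue_d (U k))%E].

(* +oo when no finite cover exists. *)
Definition covering_number (R : realType) (d : nat)
    (A : set 'rV[R]_d) (delta : R) : \bar R :=
  ereal_inf
    [set ((#|` s|)%:R : R)%:E | s in [set s : {fset 'rV[R]_d} |
        [set` s] `<=` A /\ A `<=` \bigcup_(c in [set` s]) eball c delta]].

Definition equi_homogeneous (R : realType) (d : nat)
    (F : set 'rV[R]_d) : Prop :=
  forall delta0 : R, 0 < delta0 ->
  exists M c1 c2 : R, [/\ 1 <= M, 0 < c1, 0 < c2 &
    forall delta rho : R, 0 < rho -> rho < delta -> delta <= delta0 ->
      (ereal_sup [set covering_number (eball x delta `&` F) rho | x in F] <=
       M%:E * ereal_inf
         [set covering_number (eball x (c1 * delta) `&` F) (c2 * rho)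
         | x in F])%E].

(* Main.v *)
Require Import Defs.
From HB Require Import structures.
From mathcomp Require Import all_boot all_order all_algebra finmap.
From mathcomp Require Import all_classical all_reals all_analysis.
From mathcomp Require Import zify ring lra.

Set Implicit Arguments.
Unset Strict Implicit.
Unset Printing Implicit Defensive.

Import Order.TTheory GRing.Theory Num.Theory.
Import numFieldNormedType.Exports.

Local Open Scope classical_set_scope.
Local Open Scope ring_scope.

(* A word w of length n over the index sets I (k+1), ..., I (k+n) gives a
   similarity g_w whose ratio c(n) depends only on n, and F k is the union of
   the pieces g_w (F (k + n)), which are therefore all isometric.  The images
   g_w (U (k + n)) of the Moran open sets are pairwise disjoint, and each has
   volume at least eps0 * c(n)^d, so boundedly many pieces meet a given ball of
   radius at most c(n).

   Given delta, let n be least with c(n) <= delta.  If n > 0 then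
   delta < c(n - 1), so boundedly many pieces of level n - 1, hence of level n,
   meet a ball of radius delta.  Each of them is isometric to the piece
   containing another given point y, and that piece lies in a ball about y of
   radius comparable to delta; so covers near y transfer to covers near x.

   The volume comparison is carried out with points rather than measures: an
   open set of outer measure greater than b contains, at some dyadic scale h,
   more than b / h^d grid cubes, and the images of their centres under the maps
   g_w are separated by c(n) h / 2, so that they can be counted by the
   pigeonhole principle. *)

(** * Euclidean distance and similarities *)

Section Enorm.
Variables (R : realType) (d : nat).
Implicit Types x y z : 'rV[R]_d.

Lemma enorm_ge0 x : 0 <= enorm x.
Proof. exact: sqrtr_ge0. Qed.

Lemma sqr_enorm x : enorm x ^+ 2 = \sum_(i < d) x 0 i ^+ 2.
Proof. by rewrite /enorm sqr_sqrtr // sumr_ge0 // => i _; apply: sqr_ge0. Qed.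

Lemma enormN x : enorm (- x) = enorm x.
Proof.
by rewrite /enorm; congr Num.sqrt; apply: eq_bigr => i _; rewrite mxE sqrrN.
Qed.

Lemma enormBC x y : enorm (x - y) = enorm (y - x).
Proof. by rewrite -enormN opprB. Qed.

Lemma enorm0 : enorm (0 : 'rV[R]_d) = 0.
Proof.
rewrite /enorm big1 ?sqrtr0 // => i _.
by rewrite mxE expr0n.
Qed.

Lemma coord_le_enorm x i : `|x 0 i| <= enorm x.
Proof.
rewrite -(ler_pXn2r (ltn0Sn 1)) ?nnegrE ?enorm_ge0 // sqr_enorm real_normK ?num_real //.
by rewrite (bigD1 i) //= lerDl sumr_ge0 // => j _; apply: sqr_ge0.
Qed.

Lemma enorm_le_coord x b : 0 <= b -> (forall i, `|x 0 i| <= b) ->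
  enorm x <= d%:R * b.
Proof.
move=> b0 xb.
rewrite -(ler_pXn2r (ltn0Sn 1)) ?nnegrE ?enorm_ge0 ?mulr_ge0 // sqr_enorm.
apply: (@le_trans _ _ (\sum_(i < d) b ^+ 2)).
  by apply: ler_sum => i _; rewrite -real_normK ?num_real // ler_pXn2r ?nnegrE.
rewrite sumr_const card_ord -[leLHS]mulr_natl exprMn.
apply: ler_wpM2r; first exact: sqr_ge0.
by rewrite -natrX ler_nat; case: d => // n; rewrite leq_pmulr.
Qed.

Lemma enorm0_eq0 x : enorm x = 0 -> x = 0.
Proof.
move=> x0; apply/matrixP => i j; rewrite ord1 mxE; apply/eqP.
by rewrite -normr_eq0 eq_le normr_ge0 andbT -x0 coord_le_enorm.
Qed.

(** * Inner products and the triangle inequality *)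

Definition dot x y : R := \sum_(i < d) x 0 i * y 0 i.

Lemma sqr_enormB x y :
  enorm (x - y) ^+ 2 = enorm x ^+ 2 + enorm y ^+ 2 - 2 * dot x y.
Proof.
rewrite !sqr_enorm /dot -big_split /= mulr_sumr -sumrB.
by apply: eq_bigr => i _; rewrite !mxE; ring.
Qed.

(** Cauchy-Schwarz, from the nonnegative sum of the squares of [b x_i - a y_i] with [a] and [b] the
    two norms. Zero norms are split off because the last step cancels [2 a b]. *)
Lemma dot_le x y : dot x y <= enorm x * enorm y.
Proof.
have [/enorm0_eq0-> | x0] := eqVneq (enorm x) 0.
  by rewrite /dot big1 ?mulr_ge0 ?enorm_ge0 // => i _; rewrite mxE mul0r.
have [/enorm0_eq0-> | y0] := eqVneq (enorm y) 0.
  by rewrite /dot big1 ?mulr_ge0 ?enorm_ge0 // => i _; rewrite mxE mulr0.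
set a := enorm x; set b := enorm y.
have ab0 : 0 < a * b by rewrite mulr_gt0 // lt0r ?x0 ?y0 ?enorm_ge0.
have : 0 <= \sum_i (b * x 0 i - a * y 0 i) ^+ 2.
  by apply: sumr_ge0 => i _; apply: sqr_ge0.
have -> : \sum_i (b * x 0 i - a * y 0 i) ^+ 2 =
   b ^+ 2 * a ^+ 2 + a ^+ 2 * b ^+ 2 - 2 * a * b * dot x y.
  rewrite [X in b ^+ 2 * X]sqr_enorm [X in a ^+ 2 * X]sqr_enorm /dot.
  rewrite !mulr_sumr -big_split -sumrB /=.
  by apply: eq_bigr => i _; ring.
have -> : b ^+ 2 * a ^+ 2 + a ^+ 2 * b ^+ 2 - 2 * a * b * dot x y =
  2 * (a * b) * (a * b - dot x y) by ring.
by rewrite pmulr_rge0 ?subr_ge0 // mulr_gt0 ?ltr0n.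
Qed.

Lemma enormB_le x y : enorm (x - y) <= enorm x + enorm y.
Proof.
rewrite -(ler_pXn2r (ltn0Sn 1)) ?nnegrE ?addr_ge0 ?enorm_ge0 // sqr_enormB.
have := dot_le (- x) y; rewrite enormN.
have -> : dot (- x) y = - dot x y.
  by rewrite /dot -sumrN; apply: eq_bigr => i _; rewrite mxE mulNr.
by move=> ?; lra.
Qed.

Lemma enormD_le x y : enorm (x + y) <= enorm x + enorm y.
Proof. by rewrite -{1}[y]opprK (le_trans (enormB_le _ _)) // enormN. Qed.

Lemma enormB_triangle y x z : enorm (x - z) <= enorm (x - y) + enorm (y - z).
Proof. by rewrite -{1}(subrK y x) -addrA enormD_le. Qed.

(* A map fixing 0 and scaling distances by c preserves inner products up to
   c ^ 2, so it is c times the orthogonal matrix with rows f e_i / c. *)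
Lemma similarity_surj (f : 'rV[R]_d -> 'rV[R]_d) (c : R) : 0 < c ->
  (forall x y, enorm (f x - f y) = c * enorm (x - y)) ->
  forall y, exists x, f x = y.
Proof.
move=> c0 fc; pose g x := f x - f 0.
have gc x y : enorm (g x - g y) = c * enorm (x - y).
  by rewrite /g opprB addrA subrK fc.
have gn x : enorm (g x) = c * enorm x.
  by have := gc x 0; rewrite /g subrr !subr0.
have gdot x y : dot (g x) (g y) = c ^+ 2 * dot x y.
  have := sqr_enormB (g x) (g y); rewrite gc !gn !exprMn sqr_enormB.
  by move=> ?; lra.
pose A : 'M[R]_d := \matrix_(i, j) (c^-1 * g (delta_mx 0 i) 0 j).
have dotE x y : dot x y = (x *m y^T) 0 0.
  by rewrite mxE; apply: eq_bigr => i _; rewrite mxE.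
have AAT : A *m A^T = 1%:M.
  apply/matrixP => i j; rewrite !mxE.
  transitivity (c^-1 ^+ 2 * dot (g (delta_mx 0 i)) (g (delta_mx 0 j))).
    by rewrite /dot mulr_sumr; apply: eq_bigr => k _; rewrite !mxE; ring.
  have -> : c^-1 ^+ 2 * dot (g (delta_mx 0 i)) (g (delta_mx 0 j)) =
      dot (delta_mx 0 i) (delta_mx 0 j).
    by rewrite gdot; field; rewrite gt_eqF.
  rewrite /dot.
  rewrite (bigD1 i) //= big1 => [|k ki].
    by rewrite !mxE !eqxx mul1r addr0 eq_sym.
  by rewrite !mxE (negPf ki) mul0r.
have ATA := mulmx1C AAT.
have gE x : g x = c *: (x *m A).
  (* Multiplying by the invertible matrix [A^T] turns the claim into the inner products of [g x]
     with the [g e_j], which [gdot] evaluates. *)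
  have : (g x - c *: (x *m A)) *m A^T = 0.
    rewrite mulmxBl -scalemxAl -mulmxA AAT mulmx1.
    apply/matrixP => i j; rewrite ord1 !mxE.
    transitivity (c^-1 * dot (g x) (g (delta_mx 0 j)) - c * x 0 j).
      by congr (_ - _); rewrite /dot mulr_sumr; apply: eq_bigr => k _; rewrite !mxE; ring.
    rewrite gdot /dot (bigD1 j) //= big1 => [|k kj].
      by rewrite !mxE !eqxx /=; field; rewrite gt_eqF.
    by rewrite !mxE (negPf kj) mulr0.
  move/(congr1 (mulmx^~ A)); rewrite /= -mulmxA ATA mulmx1 mul0mx.
  exact: subr0_eq.
move=> y; exists (c^-1 *: ((y - f 0) *m A^T)).
rewrite -[LHS](subrK (f 0)) -/(g _) gE -scalemxAl scalerA divff ?gt_eqF //.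
by rewrite scale1r -mulmxA ATA mulmx1 subrK.
Qed.

End Enorm.

(* Pigeonhole on a grid of mesh e / (2 d): two points in the same grid cube are
   at distance less than e. *)
Lemma size_separated_le (R : realType) (d : nat) (T : eqType) (s : seq T)
    (p : T -> 'rV[R]_d) (x : 'rV[R]_d) (r e : R) :
    (0 < d)%N -> 0 <= r -> 0 < e -> uniq s ->
    (forall t, t \in s -> enorm (p t - x) <= r) ->
    {in s &, forall t t', t != t' -> e <= enorm (p t - p t')} ->
  (size s)%:R <= (4 * r * d%:R / e + 1) ^+ d.
Proof.
move=> d0 r0 e0 us pr pe.
have dR : 0 < d%:R :> R by rewrite ltr0n.
pose h := e / (2 * d%:R).
have h0 : 0 < h by rewrite /h divr_gt0 // mulr_gt0 // ltr0n.
(* The shifted coordinates lie in [[0, 2 r]], so every cell index is at most [m]; the base of the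
   bound comes from [2 r / h = 4 r d / e]. *)
pose m := Num.trunc (2 * r / h).
pose y t (i : 'I_d) := (p t 0 i - x 0 i + r) / h.
pose idx t : {ffun 'I_d -> 'I_m.+1} := [ffun i => inord (Num.trunc (y t i))].
have prc t i : t \in s -> - r <= p t 0 i - x 0 i <= r.
  move=> ts; rewrite -ler_norml (le_trans _ (pr _ ts)) //.
  by have := coord_le_enorm (p t - x) i; rewrite !mxE.
have y0 t i : t \in s -> 0 <= y t i.
  move=> ts; have /andP[? _] := prc t i ts; apply: divr_ge0; last exact: ltW.
  by lra.
have ym t i : t \in s -> (Num.trunc (y t i) <= m)%N.
  move=> ts; have /andP[_ ?] := prc t i ts; apply: le_truncn; rewrite ler_pM2r ?invr_gt0 //.
  by lra.
have idx_inj : {in s &, injective idx}.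
  move=> t t' ts t's tt'; apply/eqP; apply: contraT => /(pe _ _ ts t's).
  rewrite leNgt => /negP[]; apply: (@le_lt_trans _ _ (d%:R * h)).
    apply: enorm_le_coord => [|i]; first exact: ltW.
    have := congr1 (fun g : {ffun 'I_d -> 'I_m.+1} => nat_of_ord (g i)) tt'.
    rewrite /= !ffunE !inordK ?ltnS ?ym // => yy'.
    have /andP[] := truncn_itv (y0 _ i ts); rewrite yy' => n1 n2.
    have /andP[n3 n4] := truncn_itv (y0 _ i t's).
    have -> : (p t - p t') 0 i = (y t i - y t' i) * h.
      by rewrite !mxE /y; field; rewrite gt_eqF.
    rewrite normrM (gtr0_norm h0) -[leRHS]mul1r ler_pM2r // ler_norml.
    by rewrite -natr1 in n2 n4; lra.
  rewrite /h; have -> : d%:R * (e / (2 * d%:R)) = e / 2.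
    by field; rewrite gt_eqF.
  by lra.
have : (size (map idx s) <= #|{ffun 'I_d -> 'I_m.+1}|)%N.
  by rewrite -(card_uniqP _) ?max_card // map_inj_in_uniq.
rewrite size_map card_ffun !card_ord -(ler_nat R) natrX => /le_trans; apply.
have r2 : 0 <= 2 * r / h by rewrite divr_ge0 ?(ltW h0) // mulr_ge0.
rewrite lerXn2r ?nnegrE ?ler0n //.
  by rewrite addr_ge0 // divr_ge0 ?(ltW e0) // !mulr_ge0 // ?ltW.
rewrite -natr1 lerD2r; have /andP[+ _] := truncn_itv r2.
move=> /le_trans; apply; rewrite le_eqVlt; apply/orP; left; apply/eqP.
by rewrite /h; field; rewrite !gt_eqF.
Qed.

(** * Dyadic cubes inside an open set *)

Section Dyadic.
Variables (R : realType) (d : nat) (a : 'rV[R]_d) (L : R) (U : set 'rV[R]_d).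
Hypotheses (d_gt0 : (0 < d)%N) (L_gt0 : 0 < L).

(** Index vectors of the [2^(j d)] closed cubes of side [mesh j] that subdivide the cube with lowest
    corner [a] and side [L]. *)
Definition cell j := {ffun 'I_d -> 'I_(2 ^ j)}.
Definition mesh j := L / 2 ^+ j.

Definition cell_lo j (v : cell j) : 'rV[R]_d :=
  \row_i (a 0 i + mesh j * (v i)%:R).
Definition cell_hi j (v : cell j) : 'rV[R]_d :=
  \row_i (a 0 i + mesh j * (v i).+1%:R).
Definition cube j (v : cell j) := box (cell_lo v) (cell_hi v).

Lemma half_cell_subproof j (i : 'I_(2 ^ j.+1)) : (i %/ 2 < 2 ^ j)%N.
Proof. by rewrite ltn_divLR // mulnC -expnS. Qed.
Definition parent j (v : cell j.+1) : cell j :=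
  [ffun i => Ordinal (half_cell_subproof (v i))].

Lemma child_cell_subproof j (i : 'I_(2 ^ j)) (b : bool) :
  (2 * i + b < 2 ^ j.+1)%N.
Proof. by rewrite expnS; have := ltn_ord i; case: b; lia. Qed.
Definition child j (v : cell j) (b : {ffun 'I_d -> bool}) : cell j.+1 :=
  [ffun i => Ordinal (child_cell_subproof (v i) (b i))].

Lemma parentK j (v : cell j) b : parent (child v b) = v.
Proof.
apply/ffunP => i; rewrite !ffunE; apply: val_inj; rewrite /= ?ffunE /=.
by case: (b i); lia.
Qed.

Lemma child_inj j (v : cell j) : injective (child v).
Proof.
move=> b b' bb'; apply/ffunP => i.
have := congr1 (fun w : cell j.+1 => val (w i)) bb'; rewrite !ffunE /=.
by case: (b i); case: (b' i) => //; lia.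
Qed.

Lemma mesh_gt0 j : 0 < mesh j.
Proof. by rewrite divr_gt0 // exprn_gt0 // ltr0n. Qed.

Lemma meshS j : mesh j = 2 * mesh j.+1.
Proof. by rewrite /mesh exprS; field; rewrite expf_neq0 // pnatr_eq0. Qed.

Lemma cube_parent j (v : cell j.+1) : cube v `<=` cube (parent v).
Proof.
move=> x xv i; have := xv i; rewrite !mxE !ffunE /= (meshS j).
move: (mesh j.+1) (mesh_gt0 j.+1) => m m0 /andP[lo hi]; apply/andP; split.
  apply: le_trans lo; rewrite lerD2l [2 * m]mulrC -mulrA ler_pM2l //.
  by rewrite -natrM ler_nat; lia.
apply: (le_trans hi); rewrite lerD2l [2 * m]mulrC -mulrA ler_pM2l //.
by rewrite -natrM ler_nat; lia.
Qed.

Definition inner j : {set cell j} := [set v | `[< cube v `<=` U >]]%SET.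

(* The inner cubes with no inner ancestor: if a cube is inner, so are all its
   descendants. *)
Definition maximal_inner j : {set cell j} :=
  match j return {set cell j} with
  | 0 => inner 0
  | j'.+1 => [set v in inner j'.+1 | parent v \notin inner j']%SET
  end.

Lemma innerP j (v : cell j) : reflect (cube v `<=` U) (v \in inner j).
Proof. by rewrite finset.in_set; apply: asboolP. Qed.

Lemma mem_maximal_innerS j (v : cell j.+1) :
  (v \in maximal_inner j.+1) = (v \in inner j.+1) && (parent v \notin inner j).
Proof. by rewrite [LHS]finset.in_set. Qed.

(** Each inner cube has [2^d] children, all inner, and none of them is maximal because its parent is
    inner. *)
Lemma card_innerS j :
  (2 ^ d * #|inner j| + #|maximal_inner j.+1| <= #|inner j.+1|)%N.
Proof.
pose X := [set child p.1 p.2 | p in finset.setX (inner j) [set: {ffun 'I_d -> bool}]]%SET.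
have XP v : v \in X -> parent v \in inner j.
  by move=> /imsetP[[w b] /=]; rewrite finset.in_setX => /andP[wj _] ->; rewrite parentK.
have -> : (2 ^ d * #|inner j|)%N = #|X|.
  rewrite card_in_imset => [|[v b] [w c] _ _ /= vw].
    by rewrite cardsX cardsT card_ffun card_bool card_ord mulnC.
  have vw' : v = w by rewrite -(parentK v b) vw parentK.
  by subst w; rewrite (child_inj vw).
have XM : (X :&: maximal_inner j.+1 = finset.set0)%SET.
  apply/setP => v; rewrite finset.in_setI mem_maximal_innerS finset.in_set0.
  by apply/negP => /and3P[/XP -> _].
rewrite -cardsUI XM cards0 addn0 subset_leq_card //.
apply/fintype.subsetP => v; rewrite finset.in_setU => /orP[/XP|].
  by move=> /innerP vU; apply/innerP; apply: subset_trans (@cube_parent _ v) vU.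
by rewrite mem_maximal_innerS => /andP[].
Qed.

(** From one level to the next the inner count grows at least by the factor [2^d], which offsets the
    smaller cube volume, and the new maximal cubes come on top. *)
Lemma sum_maximal_inner J :
  \sum_(j < J.+1) #|maximal_inner j|%:R * mesh j ^+ d <=
  #|inner J|%:R * mesh J ^+ d.
Proof.
elim: J => [|J IH]; first by rewrite big_ord1.
rewrite big_ord_recr /=; apply: le_trans (lerD IH (lexx _)) _.
rewrite [mesh J]meshS exprMn mulrA -mulrDl ler_pM2r ?exprn_gt0 ?mesh_gt0 //.
by rewrite -natrX -natrM -natrD ler_nat mulnC card_innerS.
Qed.

Lemma maximal_inner_cover j (v : cell j) x : v \in inner j -> cube v x ->
  exists j' (v' : cell j'), v' \in maximal_inner j' /\ cube v' x.
Proof.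
elim: j v => [|j IH] v vU vx; first by exists 0%N, v.
have [pU|pU] := boolP (parent v \in inner j).
  by apply: (IH _ pU); apply: cube_parent.
by exists j.+1, v; split => //; rewrite mem_maximal_innerS vU.
Qed.

Lemma cell_of_point j (x : 'rV[R]_d) :
  (forall i, a 0 i <= x 0 i < a 0 i + L) -> exists v : cell j, cube v x.
Proof.
move=> ax; have m0 := mesh_gt0 j.
pose y i := (x 0 i - a 0 i) / mesh j.
have y0 i : 0 <= y i.
  by have /andP[? _] := ax i; rewrite divr_ge0 ?(ltW m0) // subr_ge0.
(* The strict upper bound on [x] keeps the truncated index below [2 ^ j]. *)
have ylt i : (Num.trunc (y i) < 2 ^ j)%N.
  rewrite truncn_lt_nat // natrX ltr_pdivrMr //.
  rewrite /mesh mulrC divfK ?expf_neq0 ?pnatr_eq0 //.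
  by have /andP[_ ?] := ax i; lra.
exists [ffun i => Ordinal (ylt i)] => i; rewrite !mxE !ffunE /=.
have /andP[y1 y2] := truncn_itv (y0 i).
have -> : x 0 i = a 0 i + mesh j * y i by rewrite /y; field; rewrite gt_eqF.
by rewrite !lerD2l !ler_pM2l // y1 ltW.
Qed.

Lemma mesh_lt (e : R) : 0 < e -> exists j, mesh j < e.
Proof.
move=> e0; exists (Num.trunc (L / e)).+1.
rewrite ltr_pdivrMr ?exprn_gt0 // -ltr_pdivrMl // mulrC.
apply: (lt_le_trans (truncnS_gt _)).
by rewrite -natrX ler_nat ltnW // ltn_expl.
Qed.

Lemma cube_dist j (v : cell j) x y i : cube v x -> cube v y ->
  `|x 0 i - y 0 i| <= mesh j.
Proof.
move=> /(_ i) + /(_ i); rewrite !mxE -natr1 mulrDr mulr1 ler_norml.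
by move=> /andP[? ?] /andP[? ?]; apply/andP; split; lra.
Qed.

Lemma prod_cube j (v : cell j) :
  \prod_(i < d) (cell_hi v 0 i - cell_lo v 0 i) = mesh j ^+ d.
Proof.
rewrite (eq_bigr (fun _ => mesh j)) ?prodr_const ?card_ord // => i _.
by rewrite !mxE -natr1; ring.
Qed.

Hypothesis U_open : open U.
Hypothesis U_bounded : forall x, U x -> forall i, a 0 i <= x 0 i < a 0 i + L.

Lemma open_maximal_cover x : U x ->
  exists j (v : cell j), v \in maximal_inner j /\ cube v x.
Proof.
move=> Ux; have /nbhs_ballP[e /= e0 eU] : nbhs x U by apply: open_nbhs_nbhs.
(* A cube of side less than [e] containing [x] stays in the sup-norm ball about [x], hence is
   inner. *)
have [j je] := mesh_lt e0; have [v vx] := cell_of_point j (U_bounded Ux).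
apply: (@maximal_inner_cover j v) => //; apply/innerP => y vy.
by apply: eU; split => // k i; rewrite ord1; apply: le_lt_trans je; apply: cube_dist.
Qed.

Definition is_maximal (c : {j : nat & cell j}) :=
  tagged c \in maximal_inner (tag c).

(* Unused indices get the degenerate box
   at 0, which has volume 0 because 0 < d. *)
Definition cube_seq (k : nat) : 'rV[R]_d * 'rV[R]_d :=
  if pickle_inv k is Some c then
    if is_maximal c then (cell_lo (tagged c), cell_hi (tagged c)) else (0, 0)
  else (0, 0).

(** A partial sum sees only finitely many maximal cubes, so the inner cubes at their largest level
    [J] already bound its total volume. *)
Lemma cube_seq_sum_le (b : R) K :
  (forall j, #|inner j|%:R * mesh j ^+ d <= b) ->
  \sum_(0 <= k < K) \prod_(i < d) ((cube_seq k).2 0 i - (cube_seq k).1 0 i) <= b.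
Proof.
move=> innb.
pose s := [seq c <- pmap (@pickle_inv {j : nat & cell j}) (index_iota 0 K) |
   is_maximal c].
have us : uniq s.
  rewrite filter_uniq // (@pmap_uniq _ _ _ choice.pickle) ?iota_uniq //.
  exact: pickle_invK.
have prod0 : \prod_(i < d) ((0 : 'rV[R]_d) 0 i - (0 : 'rV[R]_d) 0 i) = 0.
  by rewrite (bigD1 (Ordinal d_gt0)) //= subrr mul0r.
have -> : \sum_(0 <= k < K)
    \prod_(i < d) ((cube_seq k).2 0 i - (cube_seq k).1 0 i) =
    \sum_(c <- s) mesh (tag c) ^+ d.
  rewrite big_filter [RHS]big_mkcond [RHS]big_pmap; apply: eq_bigr => k _.
  rewrite /cube_seq; case: pickle_inv => [c|] //=.
  by case: ifP => // _; exact: prod_cube.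
pose J := \max_(c <- s) tag c.
have sJ c : c \in s -> (tag c < J.+1)%N.
  by move=> cs; rewrite ltnS /J; apply: (@leq_bigmax_seq _ _ xpredT (fun c => tag c)).
apply: le_trans (innb J); apply: le_trans (sum_maximal_inner J).
have -> : \sum_(c <- s) mesh (tag c) ^+ d =
    \sum_(j < J.+1) \sum_(c <- s | tag c == j) mesh (tag c) ^+ d.
  rewrite (exchange_big_dep xpredT) //= !big_seq; apply: eq_bigr => c /sJ cJ.
  rewrite (bigD1 (Ordinal cJ)) //= big1 ?addr0 // => j /andP[/eqP cj].
  by rewrite -val_eqE /= cj eqxx.
apply: ler_sum => j _.
rewrite (eq_bigr (fun _ => mesh j ^+ d)) => [|c /eqP-> //].
rewrite big_const_seq iter_addr_0 -[leLHS]mulr_natl ler_wpM2r //.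
  by rewrite exprn_ge0 // ltW // mesh_gt0.
(* Since [s] has no repetitions, its cubes of level [j] are no more numerous than the maximal
   ones. *)
rewrite ler_nat -size_filter.
apply: (@leq_trans (size [seq Tagged cell v | v <- enum (maximal_inner j)])).
  apply: uniq_leq_size => [|c]; first exact: filter_uniq.
  rewrite !mem_filter => /and3P[/eqP cj cmax _].
  case: c cj cmax => i v /= ij; subst i; rewrite /is_maximal /= => vmax.
  by apply: map_f; rewrite mem_enum.
by rewrite size_map -cardE.
Qed.

(** The maximal inner cubes form an admissible cover in the infimum that defines the outer
    measure. *)
Lemma lebesgue_d_le_inner (b : R) :
  (forall j, #|inner j|%:R * mesh j ^+ d <= b) -> (lebesgue_d U <= b%:E)%E.
Proof.
move=> innb.
apply: (@le_trans _ _ (\sum_(0 <= k <oo)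
   (\prod_(i < d) ((cube_seq k).2 0 i - (cube_seq k).1 0 i))%:E)%E).
  apply: ereal_inf_lbound; exists cube_seq => //; split => [k i|x Ux].
    rewrite /cube_seq; case: pickle_inv => [c|] //=; case: ifP => //= _.
    by rewrite !mxE lerD2l ler_pM2l ?mesh_gt0 // ler_nat.
  have [j [v [vmax vx]]] := open_maximal_cover Ux.
  exists (choice.pickle (Tagged cell v)) => //.
  by rewrite /cube_seq pickleK_inv /is_maximal /= vmax.
apply: lime_le.
  apply: is_cvg_nneseries => k _ _; rewrite lee_fin prodr_ge0 // => i _.
  rewrite subr_ge0 /cube_seq; case: pickle_inv => [c|] //=; case: ifP => //= _.
  by rewrite !mxE lerD2l ler_pM2l ?mesh_gt0 // ler_nat.
by apply: nearW => K; rewrite sumEFin lee_fin cube_seq_sum_le.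
Qed.

Lemma inner_cubes_volume (b : R) : (b%:E < lebesgue_d U)%E ->
  exists j, b < #|inner j|%:R * mesh j ^+ d.
Proof.
move=> bU; apply: contrapT => /forallNP nb.
have := lebesgue_d_le_inner (fun j => etrans (leNgt _ _) (introT negP (nb j))).
by rewrite leNgt bU.
Qed.

(** This room around the centres inside [U] is what later separates image points belonging to
    different words. *)
Lemma inner_center_ball j (v : cell j) (y : 'rV[R]_d) : v \in inner j ->
  enorm (y - \row_i (a 0 i + mesh j * ((v i)%:R + 2^-1))) <= mesh j / 2 -> U y.
Proof.
move=> /innerP vU yc; apply: vU => i.
have := le_trans (coord_le_enorm _ i) yc; rewrite !mxE ler_norml.
by rewrite -[(v i).+1%:R]natr1 !mulrDr mulr1 => /andP[? ?]; apply/andP; split; lra.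
Qed.

Lemma center_dist j (v w : cell j) : v != w ->
  mesh j <= enorm (\row_i (a 0 i + mesh j * ((v i)%:R + 2^-1)) -
                   \row_i (a 0 i + mesh j * ((w i)%:R + 2^-1))).
Proof.
move=> vw; have [i vwi] : exists i, v i != w i.
  apply: contrapT => /forallNP vw'; move/eqP: vw; apply; apply/ffunP => i.
  by apply/eqP/negPn/negP/vw'.
apply: le_trans (coord_le_enorm _ i); rewrite !mxE.
have -> : a 0 i + mesh j * ((v i)%:R + 2^-1) - (a 0 i + mesh j * ((w i)%:R + 2^-1))
  = mesh j * ((v i)%:R - (w i)%:R) by ring.
have m0 := mesh_gt0 j.
rewrite normrM gtr0_norm // ler_peMr ?(ltW m0) //.
have : (v i < w i)%N || (w i < v i)%N by rewrite -neq_ltn.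
case/orP; rewrite -(ler_nat R) -natr1 => ?.
  by rewrite distrC ler_normr; apply/orP; left; lra.
by rewrite ler_normr; apply/orP; left; lra.
Qed.

End Dyadic.

(** * Covering numbers *)

Section Covering.
Variables (R : realType) (d : nat).

(** Centres must lie in [A], so one point is chosen in each nonempty intersection of [A] with [C t];
    the diameter bound makes its ball cover that intersection. *)
Lemma covering_number_le_size (A : set 'rV[R]_d) (rho : R) (T : eqType)
    (s : seq T) (C : T -> set 'rV[R]_d) :
    A `<=` \bigcup_(t in [set` s]) C t ->
    (forall t, t \in s -> forall x y, (A `&` C t) x -> (A `&` C t) y ->
      enorm (x - y) <= rho) ->
  (covering_number A rho <= (size s)%:R%:E)%E.
Proof.
move=> AC Crho.
pose q t := if pselect (exists x, (A `&` C t) x) is left e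
  then Some (projT1 (cid e)) else None.
have qP t x : q t = Some x -> (A `&` C t) x.
  by rewrite /q; case: pselect => // e [<-]; case: cid.
pose S := seq_fset tt (pmap q s).
apply: (@le_trans _ _ ((#|` S|)%:R%:E)).
  apply: ereal_inf_lbound; exists S => //; split => [x|x Ax].
    rewrite /= seq_fsetE mem_pmap => /mapP[t _ /esym/qP[]//].
  have [t /= ts Ctx] := AC _ Ax.
  case qt : (q t) => [y|]; last first.
    by move: qt; rewrite /q; case: pselect => // -[]; exists x.
  exists y; last by apply: (Crho t) => //; exact: qP.
  by rewrite /= seq_fsetE mem_pmap -qt map_f.
rewrite lee_fin ler_nat size_seq_fset (leq_trans (size_undup _)) //.
by rewrite size_pmap count_size.
Qed.

(* The halved radius pays for re-centering: a ball of radius rho / 2 around a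
   centre of the cover of B is carried by each h t into a set of diameter at
   most rho, and any point of that set lying in A can serve as a new centre. *)
Lemma covering_number_le_copies (A B G : set 'rV[R]_d) (rho M : R)
    (T : eqType) (s : seq T) (g : 'rV[R]_d -> 'rV[R]_d)
    (h : T -> 'rV[R]_d -> 'rV[R]_d) :
    0 < M -> (size s)%:R <= M ->
    A `<=` \bigcup_(t in [set` s]) (h t @` G) -> g @` G `<=` B ->
    (forall t, t \in s -> forall x y, enorm (h t x - h t y) = enorm (g x - g y)) ->
  (covering_number A rho <= M%:E * covering_number B (2^-1 * rho))%E.
Proof.
(* Moving [M] to the other side allows the comparison with one cover of [B] at a time. *)
move=> M0 sM Ah gB hg; rewrite -lee_pdivrMl //.
apply: le_ereal_inf_tmp => _ [s' [s'B Bs'] <-].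
rewrite lee_pdivrMl // -EFinM.
pose C (ts : T * 'rV[R]_d) :=
  h ts.1 @` [set x | enorm (ts.2 - g x) <= 2^-1 * rho].
apply: (@le_trans _ _ ((size [seq (t, c) | t <- s, c <- enum_fset s'])%:R%:E)).
  apply: (@covering_number_le_size _ _ _ _ C) => [x Ax|[t c]].
    have [t /= ts [y Gy hy]] := Ah _ Ax.
    have [c /= cs yc] := Bs' (g y) (gB _ (imageP _ Gy)).
    exists (t, c) => /=; last by exists y.
    by apply/allpairsP; exists (t, c).
  move=> /allpairsP[[t' c'] [/= ts _ [-> _]]] _ _ [_ [x xc <-]] [_ [y yc <-]].
  rewrite /= in xc yc; rewrite hg // (le_trans (enormB_triangle c _ _)) //.
  by rewrite [enorm (_ - c)]enormBC; lra.
by rewrite lee_fin size_allpairs natrM ler_wpM2r.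
Qed.

End Covering.

(** * Compositions of the maps *)

Section Words.
Variables (R : realType) (d : nat).
Variables (f : nat -> 'rV[R]_d -> 'rV[R]_d) (sigma : nat -> R).
Variable I : nat -> {fset nat}.

Fixpoint words k n : seq (seq nat) :=
  if n is n'.+1
  then [seq i :: w | i <- enum_fset (I k.+1), w <- words k.+1 n']
  else [:: [::]].

(** The first letter, taken from the lowest level, is the outermost map, as in [ifs_iter]. *)
Definition word_map (w : seq nat) : 'rV[R]_d -> 'rV[R]_d :=
  foldr (fun i g => f i \o g) id w.

Definition word_ratio (w : seq nat) : R := \prod_(i <- w) sigma i.

Lemma mem_words_cons k n i w :
  (i :: w \in words k n.+1) = (i \in I k.+1) && (w \in words k.+1 n).
Proof.
apply/allpairsP/andP => [[[j v] /= [ij vw [-> ->]]]//|[ij wn]].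
by exists (i, w).
Qed.

Lemma wordsP k n w : reflect
  (exists i v, [/\ w = i :: v, i \in I k.+1 & v \in words k.+1 n])
  (w \in words k n.+1).
Proof.
apply: (iffP allpairsP) => [[[i v] /= [? ? ->]]|[i [v [-> ? ?]]]].
  by exists i, v.
by exists (i, v).
Qed.

Lemma words_uniq k n : uniq (words k n).
Proof.
elim: n k => [|n IH] k //=.
by apply: allpairs_uniq => //= [|[i w] [j v] _ _ [-> ->]//]; apply: fset_uniq.
Qed.

Lemma words_rcons k n w i : w \in words k n -> i \in I (k + n).+1 ->
  rcons w i \in words k n.+1.
Proof.
elim: n k w => [|n IH] k w.
  by rewrite inE => /eqP-> ik; rewrite addn0 in ik; rewrite mem_words_cons ik inE.
move=> /wordsP[j [v [-> jk vk]]] ik.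
by rewrite rcons_cons mem_words_cons jk IH // addSn -addnS.
Qed.

Lemma word_map_rcons w i x : word_map (rcons w i) x = word_map w (f i x).
Proof. by elim: w => //= j w IH; rewrite -/(word_map _) IH. Qed.

Lemma ifs_iterP k n B x : ifs_iter f I k (k + n) B x <->
  exists2 w, w \in words k n & (word_map w @` B) x.
Proof.
have ifsE m : ifs_iter f I k (k + m) B = foldr (ifs_map f I) B (iota k m).
  by rewrite /ifs_iter /index_iota addKn.
rewrite {}ifsE; elim: n k x => [|n IH] k x /=.
  split => [Bx|[w]]; first by exists [::] => //; exists x.
  by rewrite inE => /eqP-> [y ? <-].
split.
  move=> [i /= ik [y /IH[w wk [z Bz <-]] <-]].
  by exists (i :: w); [rewrite mem_words_cons ik | exists z].
move=> [w /wordsP[i [v [-> ik vk]]] [z Bz <-]].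
by exists i => //=; exists (word_map v z) => //; apply/IH; exists v => //; exists z.
Qed.

Lemma attractor_wordsP F : pullback_attractor f I F -> forall k n x,
  F k x <-> exists2 w, w \in words k n & (word_map w @` F (k + n)%N) x.
Proof.
move=> [_ _ FI _] k n x; rewrite -ifs_iterP.
suff -> : F k = ifs_iter f I k (k + n) (F (k + n)%N) by [].
rewrite /ifs_iter /index_iota addKn; elim: n k {x} => [|n IH] k /=.
  by rewrite addn0.
by rewrite FI (IH k.+1) addSnnS.
Qed.

Hypothesis hifs : nonautonomous_ifs f sigma I.
Hypothesis hsim : ifs_similarities f sigma.

Lemma word_ratio_cons i w : word_ratio (i :: w) = sigma i * word_ratio w.
Proof. by rewrite /word_ratio big_cons. Qed.

Lemma word_ratio_gt0 k n w : w \in words k n -> 0 < word_ratio w.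
Proof.
elim: n k w => [|n IH] k w.
  by rewrite inE => /eqP->; rewrite /word_ratio big_nil.
move=> /wordsP[i [v [-> ik vk]]]; rewrite word_ratio_cons mulr_gt0 ?(IH k.+1) //.
by have /andP[] := nifs_ratio hifs (nifs_index hifs (ltn0Sn k) ik).
Qed.

Lemma word_map_similarity k n w x y : w \in words k n ->
  enorm (word_map w x - word_map w y) = word_ratio w * enorm (x - y).
Proof.
elim: n k w => [|n IH] k w.
  by rewrite inE => /eqP->; rewrite /word_ratio big_nil mul1r.
move=> /wordsP[i [v [-> ik vk]]]; rewrite word_ratio_cons /=.
rewrite (hsim (nifs_index hifs (ltn0Sn k) ik)).
by rewrite -/(word_map v) (IH k.+1) // mulrA.
Qed.

Lemma word_map_surj k n w : w \in words k n -> forall y, exists x, word_map w x = y.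
Proof.
move=> wk; apply: (similarity_surj (word_ratio_gt0 wk)) => x y.
exact: word_map_similarity wk.
Qed.

Lemma ifs_similarity_inj i : (0 < i)%N -> injective (f i).
Proof.
move=> i0 x y fxy; have := hsim i0 x y; rewrite fxy subrr enorm0.
have /andP[s0 _] := nifs_ratio hifs i0.
move/esym/eqP; rewrite mulf_eq0 gt_eqF //= => /eqP/enorm0_eq0/subr0_eq.
by [].
Qed.

(** * Images of the Moran open sets *)

Section OpenSets.
Variable U : nat -> set 'rV[R]_d.
Hypothesis U_sub : forall k, ifs_map f I k (U k.+1) `<=` U k.
Hypothesis U_disj : forall k i j, (0 < k)%N -> i \in I k -> j \in I k ->
  i != j -> f i @` U k `&` f j @` U k = set0.

Lemma word_map_open_sub k n w x : w \in words k n -> U (k + n)%N x ->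
  U k (word_map w x).
Proof.
elim: n k w => [|n IH] k w.
  by rewrite inE addn0 => /eqP->.
move=> /wordsP[i [v [-> ik vk]]] Ux; apply: U_sub; exists i => //=.
by exists (word_map v x) => //; apply: IH => //; rewrite addSnnS.
Qed.

(** Injectivity strips the common prefix; at the first differing letter the two images lie in
    disjoint sets [f i (U)] and [f i' (U)]. *)
Lemma word_map_open_disj k n w w' x x' : w \in words k n -> w' \in words k n ->
  U (k + n)%N x -> U (k + n)%N x' -> word_map w x = word_map w' x' -> w = w'.
Proof.
elim: n k w w' => [|n IH] k w w'.
  by rewrite !inE => /eqP-> /eqP->.
move=> /wordsP[i [v [-> ik vk]]] /wordsP[i' [v' [-> ik' vk']]].
rewrite -addSnnS => Ux Ux' /= e.
have [ii'|ii'] := eqVneq i i'; last first.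
  have : (f i @` U k.+1 `&` f i' @` U k.+1) (f i (word_map v x)).
    split; first by exists (word_map v x) => //; exact: (word_map_open_sub vk Ux).
    by exists (word_map v' x') => //; exact: (word_map_open_sub vk' Ux').
  by rewrite U_disj.
subst i'; congr (_ :: _); apply: (IH k.+1) => //.
exact: ifs_similarity_inj (nifs_index hifs (ltn0Sn k) ik) _ _ e.
Qed.

End OpenSets.

(** * The common ratio of the words of one level *)

Section EqualRatios.
Hypothesis hratio : forall k, (0 < k)%N ->
  exists c : R, forall i, i \in I k -> sigma i = c.

(** Any word would serve, so the first is taken. If there are no words, the default is the empty
    word, of ratio 1. *)
Definition level_ratio k n := word_ratio (head [::] (words k n)).

Lemma word_ratio_level k n w : w \in words k n -> word_ratio w = level_ratio k n.
Proof.
suff eqr v v' : v \in words k n -> v' \in words k n ->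
    word_ratio v = word_ratio v'.
  move=> wk; apply: eqr => //; move: wk; case: (words k n) => //= u s _.
  by rewrite inE eqxx.
elim: n k v v' => [|n IH] k v v'.
  by rewrite !inE => /eqP-> /eqP->.
move=> /wordsP[i [u [-> ik uk]]] /wordsP[i' [u' [-> ik' uk']]].
rewrite !word_ratio_cons (IH _ _ _ uk uk').
by have [c cE] := hratio (ltn0Sn k); rewrite !cE.
Qed.

End EqualRatios.

End Words.

(** * The attractor *)

Lemma bounded_set_enorm (R : realType) (d : nat) (A : set 'rV[R]_d) :
  bounded_set A -> exists2 D, 0 < D & forall x, A x -> enorm x <= D.
Proof.
case=> M [_ MA]; exists (d%:R * (`|M| + 1) + 1).
  by rewrite ltr_pwDr // mulr_ge0 // addr_ge0.
move=> x Ax; have /= xM : `|x| <= `|M| + 1.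
  by apply: MA => //; rewrite (le_lt_trans (ler_norm M)) // ltrDl.
apply: (@le_trans _ _ (d%:R * (`|M| + 1))); last by rewrite lerDl.
apply: enorm_le_coord => [|i]; first by rewrite addr_ge0.
apply: le_trans xM; rewrite [leRHS]/Num.norm /= mx_normrE.
exact: (le_bigmax _ (fun ij => `|x ij.1 ij.2|) (0, i)).
Qed.

Section Attractor.
Variables (R : realType) (d : nat) (d_gt0 : (0 < d)%N).
Variables (f : nat -> 'rV[R]_d -> 'rV[R]_d) (sigma : nat -> R).
Variables (I : nat -> {fset nat}) (F : nat -> set 'rV[R]_d).
Hypothesis hifs : nonautonomous_ifs f sigma I.
Hypothesis hsim : ifs_similarities f sigma.
Hypothesis hF : pullback_attractor f I F.
Hypothesis hratio : forall k, (0 < k)%N ->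
  exists c : R, forall i, i \in I k -> sigma i = c.

(* Compositions of length n send a pair of points at mutual distance 2 T into a
   bounded set once n is large, so that T * level_ratio k n is bounded. *)
Lemma level_ratio_le k (delta : R) : F k !=set0 -> 0 < delta ->
  exists n, level_ratio sigma I k n <= delta.
Proof.
move=> [x0 Fx0] delta0.
have [D D0 FD] := bounded_set_enorm (pa_bounded hF).
(* Chosen so that [c * 2 T <= 2 (D + 1)] reads [c <= delta]. *)
pose T := (D + 1) / delta.
have T0 : 0 < T by rewrite divr_gt0 // addr_gt0.
pose z : 'rV[R]_d := const_mx T.
have B_bounded : bounded_set [set z; - z].
  exists `|z|; split; first exact: num_real.
  by move=> M zM x [->|->] /=; rewrite ?normrN ltW.
have := pa_attracting hF k B_bounded.
move=> /(_ [set y | (y < 1%:E)%E]) [|n _ nB].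
  by apply: open_ereal_lt'; rewrite lte_fin.
have {nB} := nB (k + n)%N (leq_addl _ _); rewrite /= gt_max => /andP[_ zn].
(* A point of [F k] provides an actual word of length [n], so that [level_ratio] is not the default
   value. *)
have [w wk _] := (attractor_wordsP hF k n x0).1 Fx0.
have zD u : [set z; - z] u -> enorm (word_map f w u) <= D + 1.
  move=> zu; have : (ereal_inf [set (enorm (word_map f w u - y))%:E | y in F k] < 1%:E)%E.
    apply: le_lt_trans zn; apply: ereal_sup_ubound.
    exists (word_map f w u) => //; apply/ifs_iterP.
    by exists w => //; exists u.
  move=> /ereal_inf_lt[_ [y Fy <-]]; rewrite lte_fin => uy.
  rewrite -(subrK y (word_map f w u)) (le_trans (enormD_le _ _)) // [leLHS]addrC.
  by rewrite lerD ?(ltW uy) // FD //; exists k.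
exists n; rewrite -(word_ratio_level hratio wk).
have : word_ratio sigma w * (2 * T) <= 2 * (D + 1).
  apply: (@le_trans _ _ (word_ratio sigma w * enorm (z - - z))).
    rewrite ler_pM2l ?(word_ratio_gt0 hifs wk) //.
    apply: le_trans (coord_le_enorm _ (Ordinal d_gt0)).
    by rewrite !mxE opprK ler_normr; apply/orP; left; lra.
  rewrite -(word_map_similarity hifs hsim _ _ wk).
  have := enormB_le (word_map f w z) (word_map f w (- z)).
  by have := zD _ (or_introl erefl); have := zD _ (or_intror erefl); lra.
rewrite mulrCA ler_pM2l // /T mulrA ler_pdivrMr // [leRHS]mulrC.
by rewrite ler_pM2r // addr_gt0.
Qed.

Hypothesis hmoran : moran_open_set_condition f I.

(** With [c] the level ratio, each word contributes the images of all centres of inner cubes of side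
    [h]. These points are [c h / 2] separated in a ball of radius [c (2 D + 1)]; the volume bound
    [#|A| h^d > eps / 2] cancels [h], so [K] is uniform in [k], [m], [x] and [r]. *)
Lemma words_meeting_ball : exists2 K : R, 0 <= K &
  forall k m (x : 'rV[R]_d) r (s : seq (seq nat)), uniq s ->
    {subset s <= words I k m} -> r <= level_ratio sigma I k m ->
    (forall w, w \in s ->
      exists2 y, F (k + m)%N y & enorm (word_map f w y - x) <= r) ->
  (size s)%:R <= K.
Proof.
have [U [U_open U_bounded U_sub U_disj [eps eps0 U_eps]]] := hmoran.
have [D1 D10 FD1] := bounded_set_enorm (pa_bounded hF).
have [D2 D20 UD2] := bounded_set_enorm U_bounded.
pose D := D1 + D2; have D0 : 0 < D by rewrite addr_gt0.
have FD k y : F k y -> enorm y <= D.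
  by move=> Fy; rewrite (le_trans (FD1 y _)) ?lerDl ?ltW //; exists k.
have UD k y : U k y -> enorm y <= D.
  by move=> Uy; rewrite (le_trans (UD2 y _)) ?lerDr ?ltW //; exists k.
have dR : 0 < d%:R :> R by rewrite ltr0n.
(* The pigeonhole bound has base [(8 (2 D + 1) d + h) / h], and [h] is at most [L = 3 D]. *)
pose Q := 8 * (2 * D + 1) * d%:R + 3 * D.
have Q0 : 0 < Q by rewrite addr_gt0 ?mulr_gt0 ?ltr0n // addr_gt0 ?mulr_gt0 ?ltr0n.
exists (Q ^+ d * 2 / eps).
  by rewrite divr_ge0 ?(ltW eps0) // mulr_ge0 // exprn_ge0 // ltW.
move=> k m x r s us sk rc sx.
pose a : 'rV[R]_d := const_mx (- D).
(* A side larger than [2 D] gives the strict upper bound required by the half-open enclosing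
   cube. *)
pose L := 3 * D; have L0 : 0 < L by rewrite mulr_gt0 ?ltr0n.
have UaL y : U (k + m)%N y -> forall i, a 0 i <= y 0 i < a 0 i + L.
  move=> /UD yD i; have := le_trans (coord_le_enorm y i) yD.
  by rewrite ler_norml mxE /L => /andP[? ?]; apply/andP; split; lra.
have [j] : exists j, eps / 2 < #|inner a L (U (k + m)%N) j|%:R * mesh L j ^+ d.
  apply: inner_cubes_volume => //; first exact: (U_open _).1.
  by apply: lt_le_trans (U_eps _); rewrite lte_fin; lra.
set A := inner _ _ _ j; set h := mesh L j => Ah.
have h0 : 0 < h by exact: mesh_gt0.
have hL : h <= L.
  rewrite /h /mesh ler_pdivrMr ?exprn_gt0 ?ltr0n // ler_peMr ?(ltW L0) //.
  by rewrite exprn_ege1 // ler1n.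
pose ctr (v : cell d j) : 'rV[R]_d := \row_i (a 0 i + h * ((v i)%:R + 2^-1)).
have ctrU v y : v \in A -> enorm (y - ctr v) <= h / 2 -> U (k + m)%N y.
  exact: inner_center_ball.
have ctr_U v : v \in A -> U (k + m)%N (ctr v).
  by move=> vA; apply: (ctrU v) => //; rewrite subrr enorm0 divr_ge0 ?ltW.
(* The empty list is treated apart, since positivity of [c] is read off from a word of [s]. *)
have [s0|[w0 w0s]] : s = [::] \/ exists w, w \in s.
- by case: (s) => [|w s']; [left | right; exists w; rewrite inE eqxx].
- by rewrite s0 divr_ge0 ?(ltW eps0) // mulr_ge0 // exprn_ge0 // ltW.
pose c := level_ratio sigma I k m.
have rE w : w \in s -> word_ratio sigma w = c.
  by move=> /sk; apply: word_ratio_level.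
have c0 : 0 < c by rewrite -(rE _ w0s) (word_ratio_gt0 hifs (sk _ w0s)).
have dE w y y' : w \in s ->
    enorm (word_map f w y - word_map f w y') = c * enorm (y - y').
  by move=> ws; rewrite (word_map_similarity hifs hsim _ _ (sk _ ws)) rE.
pose pts := [seq (w, v) | w <- s, v <- enum A].
have upts : uniq pts.
  by apply: allpairs_uniq => //= [|[? ?] [? ?] _ _ [-> ->]//]; exact: enum_uniq.
have ptsP w v : (w, v) \in pts -> w \in s /\ v \in A.
  by move=> /allpairsP[[? ?] [/= ? + [-> ->]]]; rewrite mem_enum.
pose p (t : seq nat * cell d j) := word_map f t.1 (ctr t.2).
have p_ball t : t \in pts -> enorm (p t - x) <= c * (2 * D + 1).
  case: t => w v /ptsP[ws vA]; have [y Fy yr] := sx _ ws.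
  apply: (le_trans (enormB_triangle (word_map f w y) _ _)).
  rewrite /p /= dE // mulrDr mulr1 lerD // ?(le_trans yr) //.
  rewrite ler_pM2l // (le_trans (enormB_le _ _)) // mulrDl mul1r.
  by rewrite lerD // ?(UD _ _ (ctr_U _ vA)) ?(FD _ _ Fy).
have p_sep : {in pts &, forall t t', t != t' -> c * h / 2 <= enorm (p t - p t')}.
  move=> [w v] [w' v'] /ptsP[ws vA] /ptsP[w's v'A] tt'.
  have [ww'|ww'] := eqVneq w w'.
    have vv' : v != v' by apply: contra_neq tt' => ->; rewrite ww'.
    subst w'; rewrite /p /= dE //.
    have /(_ a) := center_dist _ L0 vv'; rewrite -/h => hvv'.
    have : c * h <= c * enorm (ctr v - ctr v') by rewrite ler_pM2l.
    have : 0 < c * h by exact: mulr_gt0.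
    by lra.
  (* If the points were closer, the second would be the image under [w] of some [u] within [h / 2]
     of [ctr v]. Then [u] lies in the open set, and disjointness forces [w = w']. *)
  rewrite leNgt; apply/negP => pp.
  have [u uE] := word_map_surj hifs hsim (sk _ ws) (p (w', v')).
  move/eqP: ww'; apply; have Uu : U (k + m)%N u.
    apply: (ctrU v) => //; rewrite -(ler_pM2l c0) -(dE w) // uE enormBC mulrA.
    exact: ltW.
  by have := word_map_open_disj hifs hsim U_sub U_disj (sk _ ws) (sk _ w's) Uu (ctr_U _ v'A) uE.
have := size_separated_le d_gt0 _ _ upts p_ball p_sep.
rewrite size_allpairs -cardE => /(_ _ _)/le_trans sz.
have {}sz : (size s)%:R * #|A|%:R <= (Q / h) ^+ d.
  rewrite -natrM; apply: sz.
  - by rewrite mulr_ge0 ?(ltW c0) // addr_ge0 // mulr_ge0 // ltW.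
  - by rewrite divr_gt0 ?mulr_gt0 ?ltr0n.
  have -> : 4 * (c * (2 * D + 1)) * d%:R / (c * h / 2) + 1 =
     (8 * (2 * D + 1) * d%:R + h) / h by field; rewrite !gt_eqF.
  have E0 : 0 <= 8 * (2 * D + 1) * d%:R + h.
    by rewrite addr_ge0 ?(ltW h0) // !mulr_ge0 // addr_ge0 // mulr_ge0 // ltW.
  apply: lerXn2r; rewrite ?nnegrE.
  - exact: divr_ge0 E0 (ltW h0).
  - exact: divr_ge0 (ltW Q0) (ltW h0).
  by rewrite ler_pM2r ?invr_gt0 // lerD2l.
rewrite ler_pdivlMr // -ler_pdivrMr ?ltr0n // -mulrA.
apply: (@le_trans _ _ ((size s)%:R * (#|A|%:R * h ^+ d))).
  by rewrite ler_wpM2l // ltW.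
by rewrite mulrA -ler_pdivlMr ?exprn_gt0 // -expr_div_n.
Qed.

End Attractor.

(** * Transfer of covers between pieces of the same level *)

Theorem theorem1p5 (R : realType) (d : nat) (hd : (0 < d)%N)
    (f : nat -> 'rV[R]_d -> 'rV[R]_d) (sigma : nat -> R)
    (I : nat -> {fset nat}) (F : nat -> set 'rV[R]_d)
    (hifs : nonautonomous_ifs f sigma I)
    (hsim : ifs_similarities f sigma)
    (hF : pullback_attractor f I F)
    (hmoran : moran_open_set_condition f I)
    (hratio : forall k, (0 < k)%N ->
      exists c : R, forall i, i \in I k -> sigma i = c)
    (hcard : exists2 N : nat, (0 < N)%N &
      forall k, (0 < k)%N -> (#|` I k| <= N)%N) :
  forall k, equi_homogeneous (F k).
Proof.
move=> k delta0 _.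
have [N _ cardN] := hcard.
have [K K0 KP] := words_meeting_ball hd hifs hsim hF hratio hmoran.
have [D D0 FD] := bounded_set_enorm (pa_bounded hF).
(* The summand 1 serves level 0 and [K * N] the positive levels; [2 * D] bounds distances within
   each [F] set, and [2^-1] pays for re-centering. *)
exists (1 + K * N%:R), (2 * D), 2^-1.
split; rewrite ?invr_gt0 ?mulr_gt0 ?ltr0n // ?lerDl ?mulr_ge0 //.
move=> delta rho rho0 rho_delta _.
have M0 : 0 < 1 + K * N%:R by rewrite ltr_pwDl // mulr_ge0.
apply: ge_ereal_sup => _ [x Fx <-]; rewrite -lee_pdivrMl //.
apply: le_ereal_inf_tmp => _ [y Fy <-]; rewrite lee_pdivrMl //.
have delta_gt0 : 0 < delta by exact: lt_trans rho_delta.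
have level_ex : exists n, level_ratio sigma I k n <= delta.
  by apply: (level_ratio_le hd hifs hsim hF hratio) => //; exists x.
case: (ex_minnP level_ex) => n ndelta nmin.
have [w0 w0k [y0 Fy0 y0E]] := (attractor_wordsP hF k n y).1 Fy.
have [s [sk sM sx]] : exists s, [/\ {subset s <= words I k n},
    (size s)%:R <= 1 + K * N%:R &
    eball x delta `&` F k `<=` \bigcup_(w in [set` s]) (word_map f w @` F (k + n)%N)].
  (* At level 0 the only piece is [F k] itself. Otherwise the words of the preceding level [m] whose
     pieces meet the ball are counted and then extended by one letter. *)
  case: n ndelta nmin {w0 w0k y0 Fy0 y0E} => [|m] _ nmin.
    exists [:: [::]]; split=> //; first by rewrite lerDl mulr_ge0.
    by move=> z [_ Fz]; exists [::]; [rewrite /= inE | exists z; rewrite ?addn0].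
  pose s := [seq w <- words I k m |
     `[< exists2 z, F (k + m)%N z & enorm (word_map f w z - x) <= delta >]].
  have sK : (size s)%:R <= K.
    apply: (KP k m x delta).
    - by rewrite filter_uniq // words_uniq.
    - by move=> w; rewrite mem_filter => /andP[].
    (* Minimality of [m + 1] gives [delta < level_ratio k m]. *)
    - by rewrite leNgt; apply/negP => /ltW/nmin; rewrite ltnn.
    - by move=> w; rewrite mem_filter => /andP[/asboolP].
  exists [seq rcons w i | w <- s, i <- enum_fset (I (k + m).+1)]; split.
  - move=> _ /allpairsP[[w i] [/= + ik ->]]; rewrite mem_filter => /andP[_ wk].
    exact: words_rcons.
  - rewrite size_allpairs natrM (@le_trans _ _ (K * N%:R)) ?lerDr //.
    by rewrite ler_pM // ler_nat cardN.
  move=> z [xz /(attractor_wordsP hF k m)[w wk [u Fu uz]]].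
  have := Fu; rewrite (pa_invariant hF) => -[i /= ik [v Fv vu]].
  exists (rcons w i); last first.
    by exists v; rewrite ?addnS // word_map_rcons vu.
  apply/allpairsP; exists (w, i); split => //=; rewrite mem_filter wk andbT.
  by apply/asboolP; exists u => //; rewrite uz enormBC.
(* The piece of [w0] contains [y] and has diameter at most [2 D] times the level ratio, so it lies
   in the ball of radius [2 D delta] about [y]. The pieces of [s] are isometric to it. *)
apply: (@covering_number_le_copies _ _ _ _ (F (k + n)%N) _ _ _ s (word_map f w0) (word_map f)) => //.
  move=> _ [z Fz <-]; split; last first.
    by apply/(attractor_wordsP hF k n); exists w0 => //; exists z.
  rewrite /eball /closed_ball_ /= -y0E (word_map_similarity hifs hsim _ _ w0k).
  rewrite (word_ratio_level hratio w0k) mulrC ler_pM ?enorm_ge0 //.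
    by rewrite -(word_ratio_level hratio w0k) (ltW (word_ratio_gt0 hifs w0k)).
  rewrite (le_trans (enormB_le _ _)) // mulrDl mul1r.
  by rewrite lerD // FD //; exists (k + n)%N.
move=> w ws u v; rewrite (word_map_similarity hifs hsim _ _ w0k).
rewrite (word_map_similarity hifs hsim _ _ (sk _ ws)).
by rewrite (word_ratio_level hratio w0k) (word_ratio_level hratio (sk _ ws)).
Qed.
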